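(* Let $H$ be a real Hilbert space, let $G$ be a group acting isometrically on $H$, let $t_0\in H$, and for $\sigma>0$ let $Y=\phi\cdot t_0+\sigma\epsilon$, where $\phi$ is a random element of $G$ and $\epsilon$ is an $H$-valued random variable independent of $\phi$ with $\mathbb{E}(\epsilon)=0$ and $\mathbb{E}(\|\epsilon\|^2)=1$. Suppose that the support of $\epsilon$ is not included in the set $\{x\in H : g\cdot x=x \text{ for all } g\in G\}$ of fixed points of the action. Define $$K=\sup_{\|v\|=1}\mathbb{E}\left(\sup_{g\in G}\langle g\cdot v,\epsilon\rangle\right),$$ a constant which depends only on the standardized noise $\epsilon$ and on the group action. Then $K\in(0,1]$. If the Fréchet mean of $[Y]$ exists, then the consistency bias $CB$ satisfies $$\sigma K-2\|t_0\|\le CB\le \sigma K+2\|t_0\|.$$ Moreover, when the noise level $\sigma$ tends to infinity (with $t_0$, $\phi$, $\epsilon$ and the action fixed, and the Fréchet mean of $[Y]$ existing for the values of $\sigma$ considered), $$CB=\sigma K+o(\sigma)\quad\text{as }\sigma\to+\infty.$$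
   Context: $H$ is a Hilbert space with inner product $\langle\cdot,\cdot\rangle$ and norm $\|\cdot\|$. The group $G$ (with identity $e$) acts isometrically on $H$: for each $g\in G$ the map $x\mapsto g\cdot x$ is a linear automorphism of $H$ with $\|g\cdot x\|=\|x\|$, and $g'\cdot(g\cdot x)=(g'g)\cdot x$, $e\cdot x=x$ for all $x\in H$, $g,g'\in G$. The support of $\epsilon$ is the set of $x\in H$ such that $\mathbb{P}(\epsilon\in B(x,r))>0$ for every $r>0$, where $B(x,r)$ is the ball of center $x$ and radius $r$. The orbit of $x\in H$ is $[x]=\{g\cdot x : g\in G\}$. The quotient $H/G$ is equipped with the pseudometric $d_Q([x],[y])=\inf_{g\in G}\|x-g\cdot y\|=\inf_{g\in G}\|g\cdot x-y\|$. The variance of the random orbit $[Y]$ at $x\in H$ is $F(x)=\mathbb{E}(d_Q^2([x],[Y]))=\mathbb{E}\left(\inf_{g\in G}\|x-g\cdot Y\|^2\right)$, which is finite for all $x$. If $m_\star\in H$ minimizes $F$ over $H$, then $[m_\star]$ is called a Fréchet mean of $[Y]$; ''the Fréchet mean of $[Y]$ exists'' means such an $m_\star$ exists. The consistency bias is $CB=d_Q([t_0],[m_\star])$, where $m_\star$ is a minimizer of $F$. $F$, $m_\star$ and $CB$ depend on $\sigma$ through $Y$. *)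

(* Defs.v *)
(* MathComp / MathComp-Analysis *)
From HB Require Import structures.
From mathcomp Require Import all_boot all_order all_algebra.
From mathcomp Require Import all_classical all_reals all_analysis.

Set Implicit Arguments.
Unset Strict Implicit.
Unset Printing Implicit Defensive.

Import Order.TTheory GRing.Theory Num.Theory.
Import numFieldNormedType.Exports.

Local Open Scope classical_set_scope.
Local Open Scope ring_scope.

(* A real Hilbert space is a complete normed space H with an inner product
   ip : {dot H for idfun} (symmetric, bilinear, positive definite) that
   induces the norm of H. *)
Definition induces_norm (R : realType) (H : completeNormedModType R)
    (ip : {dot H for idfun}) : Prop :=
  forall x : H, `|x| ^+ 2 = ip x x.

(* act g is bijective, with inverse act g^-1, by the last two axioms. *)
Record isometric_action (R : realType) (H : completeNormedModType R)
    (G : groupType) (act : G -> H -> H) : Prop := IsometricAction {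
  act_linear : forall g, linear (act g);
  act_norm : forall g x, `|act g x| = `|x|;
  act_mul : forall g' g x, act g' (act g x) = act (g' * g)%g x;
  act_one : forall x, act 1%g x = x
}.

Definition fixed_points (R : realType) (H : completeNormedModType R)
    (G : groupType) (act : G -> H -> H) : set H :=
  [set x | forall g, act g x = x].

Definition borel_sets (H : topologicalType) : set (set H) := <<s @open H >>.
Arguments borel_sets : clear implicits.

(* SE is the sigma-algebra of E. *)
Definition random_element (d : measure_display) (T : measurableType d)
    (E : Type) (SE : set (set E)) (X : T -> E) : Prop :=
  forall A, SE A -> measurable (X @^-1` A).

Definition independent (d : measure_display) (T : measurableType d)
    (R : realType) (P : probability T R) (E F : Type)
    (SE : set (set E)) (SF : set (set F)) (X : T -> E) (Z : T -> F) : Prop :=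
  forall A B, SE A -> SF B ->
    P (X @^-1` A `&` Z @^-1` B) = (P (X @^-1` A) * P (Z @^-1` B))%E.

(* The expectation of an H-valued random variable, in the weak sense: it is the
   vector representing the linear form v |-> E <v, X>. *)
Definition has_mean (R : realType) (H : completeNormedModType R)
    (ip : {dot H for idfun}) (d : measure_display) (T : measurableType d)
    (P : probability T R) (X : T -> H) (mu : H) : Prop :=
  forall v : H, P.-integrable setT (fun w => (ip v (X w))%:E) /\
    ('E_P[fun w => ip v (X w)] = (ip v mu)%:E)%E.

Definition rv_support (R : realType) (H : completeNormedModType R)
    (d : measure_display) (T : measurableType d)
    (P : probability T R) (X : T -> H) : set H :=
  [set x | forall r : R, 0 < r -> (0 < P (X @^-1` ball x r))%E].

(* Written on representatives: dQ act x y depends only on the orbits of x and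
   y when act is an isometric action. *)
Definition dQ (R : realType) (H : completeNormedModType R)
    (G : groupType) (act : G -> H -> H) (x y : H) : R :=
  inf [set `|x - act g y| | g in [set: G]].

Definition observation (R : realType) (H : completeNormedModType R)
    (G : groupType) (act : G -> H -> H) (T : Type)
    (phi : T -> G) (t0 : H) (eps : T -> H) (sigma : R) : T -> H :=
  fun w => act (phi w) t0 + sigma *: eps w.

Definition variance_at (R : realType) (H : completeNormedModType R)
    (G : groupType) (act : G -> H -> H) (d : measure_display)
    (T : measurableType d) (P : probability T R) (Y : T -> H) (x : H) : \bar R :=
  ('E_P[fun w => (dQ act x (Y w) ^+ 2)%R])%E.

(* The orbit of m is a Frechet mean of the random orbit of Y. *)
Definition frechet_mean (R : realType) (H : completeNormedModType R)
    (G : groupType) (act : G -> H -> H) (d : measure_display)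
    (T : measurableType d) (P : probability T R) (Y : T -> H) (m : H) : Prop :=
  forall x : H, (variance_at act P Y m <= variance_at act P Y x)%E.

Definition consistency_bias (R : realType) (H : completeNormedModType R)
    (G : groupType) (act : G -> H -> H) (t0 m : H) : R := dQ act t0 m.

(* The inner supremum is that of a set of reals bounded by `|v| * `|eps w|;
   the outer one is taken in \bar R. *)
Definition noise_constant (R : realType) (H : completeNormedModType R)
    (ip : {dot H for idfun}) (G : groupType) (act : G -> H -> H)
    (d : measure_display) (T : measurableType d) (P : probability T R)
    (eps : T -> H) : \bar R :=
  ereal_sup [set 'E_P[fun w => sup [set ip (act g v) (eps w) | g in [set: G]]]%E
            | v in [set v : H | `|v| = 1]].

(* Needed by the little-o notation at +oo. *)
Canonical pinfty_filter_on (R : numFieldType) :=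
  FilterType (pinfty_nbhs R) (@proper_pinfty_nbhs R).

(* Main.v *)
Require Import Defs.
From HB Require Import structures.
From mathcomp Require Import all_boot all_order all_algebra.
From mathcomp Require Import all_classical all_reals all_analysis.
From mathcomp Require Import measurable_realfun ring lra.

Set Implicit Arguments.
Unset Strict Implicit.
Unset Printing Implicit Defensive.

Import Order.TTheory GRing.Theory Num.Theory.
Import numFieldNormedType.Exports.

Local Open Scope classical_set_scope.
Local Open Scope ring_scope.

(** Expanding the square and moving the group element across the inner product
    gives
      d_Q(x, y)^2 = |x|^2 + |y|^2 - 2 theta(x, y),
      theta(x, y) = sup_g <g x, y>,
    so the variance of the random orbit of X is, up to the constant E|X|^2,
      F(x) = |x|^2 - 2 A_X(x),   A_X(x) = E theta(x, X)
    (lemmas [sqr_dQ] and [variance_atE]).  Since A_X is positively homogeneous,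
    minimising F along a ray s v with |v| = 1 is minimising the parabola
    s^2 - 2 s A_X(v) over s >= 0.  Hence a minimiser m satisfies
    A_X(m) = |m|^2, and A_X(v) <= |m| |v| for all v
    ([frechet_mean_mean_orbit_sup]): |m| is the supremum of A_X over the unit
    sphere, or 0 if that supremum is negative.

    For the noise alone that supremum is K.  The observation Y is sigma * eps
    translated by a vector of norm |t0|, and theta(v, .) is |v|-Lipschitz, so
    |A_Y(v) - sigma A_eps(v)| <= |t0| on the unit sphere
    ([mean_orbit_sup_perturbation]), and |m| differs from sigma K by at most
    |t0|.  The orbit distance from t0 to m differs from |m| by at most |t0|
    ([dQ_bounds]), whence the two bounds with the constant 2 |t0|; the latter
    does not grow with sigma, which gives the asymptotic expansion.

    K <= 1 because theta(v, eps) <= |v| |eps| <= |v| (1 + |eps|^2) / 2.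
    For K > 0, take x in the support and g0 with g0 x != x, and v = g0^-1 x:
    theta(v, .) - <v, .> is nonnegative, has expectation A_eps(v) because eps is
    centered, and is bounded below by a positive constant on a ball around x,
    where <g0 v, .> = <x, .> beats <v, .> ([exists_mean_orbit_sup_gt0]). *)

(** * The orbit distance in terms of inner products *)

Section Geometry.
Context (R : realType) (H : completeNormedModType R).
Context (ip : {dot H for idfun}) (hip : induces_norm ip).
Context (G : groupType) (act : G -> H -> H) (hact : isometric_action act).

Lemma dotC (x y : H) : ip x y = ip y x.
Proof. by rewrite hermC expr0 mul1r. Qed.

Lemma sqr_normB (x y : H) : `|x - y| ^+ 2 = `|x| ^+ 2 + `|y| ^+ 2 - 2 * ip x y.
Proof. by rewrite !hip linearBl !linearBr /= (dotC y x); ring. Qed.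

(** The Cauchy-Schwarz inequality, read off from the reverse triangle
    inequality | |x| - |y| | <= |x - y| by squaring. *)
Lemma dot_le_norm (x y : H) : ip x y <= `|x| * `|y|.
Proof.
have : (`|x| - `|y|) ^+ 2 <= `|x - y| ^+ 2.
  by rewrite -real_normK ?num_real// ler_sqr ?nnegrE// ler_dist_dist.
by rewrite sqr_normB sqrrB; lra.
Qed.

(** A linear isometry preserves inner products by polarization; here it is
    applied to x - g^-1 y, which g maps to g x - y. *)
Lemma act_adjoint g (x y : H) : ip (act g x) y = ip x (act g^-1%g y).
Proof.
have hB : act g (x - act g^-1%g y) = act g x - y.
  rewrite -[x - _]addrC -scaleN1r (act_linear hact g) scaleN1r.
  by rewrite (act_mul hact) mulgV (act_one hact) addrC.
have := congr1 (fun z => `|z| ^+ 2) hB.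
by rewrite /= (act_norm hact) !sqr_normB !(act_norm hact); lra.
Qed.

(** The support function of the orbit of v, evaluated at y. *)
Definition orbit_sup (v y : H) : R := sup [set ip (act g v) y | g in [set: G]].

Lemma orbit_sup_le (v y : H) (c : R) :
  (forall g, ip (act g v) y <= c) -> orbit_sup v y <= c.
Proof.
move=> le_c; apply: ge_sup; first by exists (ip (act 1%g v) y); exists 1%g.
by move=> _ [g _ <-].
Qed.

Lemma le_orbit_sup g (v y : H) : ip (act g v) y <= orbit_sup v y.
Proof.
apply: ub_le_sup; last by exists g.
exists (`|v| * `|y|) => _ [h _ <-].
by rewrite -(act_norm hact h v) dot_le_norm.
Qed.

Lemma dot_le_orbit_sup (v y : H) : ip v y <= orbit_sup v y.
Proof. by have := le_orbit_sup 1%g v y; rewrite (act_one hact). Qed.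

Lemma actZ g (s : R) (v : H) : act g (s *: v) = s *: act g v.
Proof.
have act0 : act g 0 = 0 by apply/normr0_eq0; rewrite (act_norm hact) normr0.
by rewrite -[s *: v]addr0 (act_linear hact g) act0 addr0.
Qed.

Lemma orbit_supZ (s t : R) (v y : H) : 0 <= s -> 0 <= t ->
  orbit_sup (s *: v) (t *: y) = s * t * orbit_sup v y.
Proof.
move=> s0 t0.
have ipZ g : ip (act g (s *: v)) (t *: y) = s * t * ip (act g v) y.
  by rewrite actZ linearZl_LR linearZr_LR /= mulrA.
apply/le_anti/andP; split.
  by apply: orbit_sup_le => g; rewrite ipZ ler_wpM2l ?mulr_ge0 ?le_orbit_sup.
have [st0|st_neq0] := eqVneq (s * t) 0.
  by have := le_orbit_sup 1%g (s *: v) (t *: y); rewrite ipZ st0 !mul0r.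
have st_gt0 : 0 < s * t by rewrite lt0r st_neq0 mulr_ge0.
rewrite -ler_pdivlMl//; apply: orbit_sup_le => g.
by rewrite ler_pdivlMl// -ipZ le_orbit_sup.
Qed.

(** A supremum of linear forms all of norm |v|. *)
Lemma orbit_sup_lipschitz (v y z : H) :
  orbit_sup v y <= orbit_sup v z + `|v| * `|y - z|.
Proof.
apply: orbit_sup_le => g; rewrite -[y in ip _ y](subrK z) linearDr /= addrC.
by rewrite lerD ?le_orbit_sup// -(act_norm hact g v) dot_le_norm.
Qed.

Lemma normr_orbit_sup (v y : H) : `|orbit_sup v y| <= `|v| * `|y|.
Proof.
have z0 : orbit_sup v 0 = 0.
  have := @orbit_supZ 1 0 v 0 ler01 (lexx 0).
  by rewrite scaler0 scale1r mulr0 mul0r.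
have := orbit_sup_lipschitz v y 0; have := orbit_sup_lipschitz v 0 y.
by rewrite z0 subr0 sub0r normrN ler_norml; lra.
Qed.

Lemma continuous_orbit_sup (v : H) : continuous (orbit_sup v).
Proof.
move=> y; apply/(@cvgrPdist_lt _ R^o) => e e0.
have v1 : 0 < `|v| + 1 by rewrite ltr_wpDl.
near=> z.
have le1 : `|orbit_sup v y - orbit_sup v z| <= `|v| * `|y - z|.
  have := orbit_sup_lipschitz v z y; have := orbit_sup_lipschitz v y z.
  by rewrite (distrC z y) ler_norml; lra.
apply: (le_lt_trans le1).
have le2 : `|v| * `|y - z| <= (`|v| + 1) * `|y - z|.
  by rewrite ler_wpM2r// lerDl.
apply: (le_lt_trans le2); rewrite -ltr_pdivlMl//.
near: z; apply: (@cvgr_dist_lt _ _ _ (nbhs y) _ id y cvg_id).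
by rewrite mulr_gt0 ?invr_gt0.
Unshelve. all: by end_near. Qed.

Lemma le_dQ (x y : H) (c : R) :
  (forall g, c <= `|x - act g y|) -> c <= dQ act x y.
Proof.
move=> le_c; apply: lb_le_inf; first by exists `|x - act 1%g y|; exists 1%g.
by move=> _ [g _ <-].
Qed.

Lemma dQ_ge0 (x y : H) : 0 <= dQ act x y.
Proof. by apply: le_dQ. Qed.

Lemma dQ_le (x y : H) g : dQ act x y <= `|x - act g y|.
Proof.
by apply: ge_inf; [exists 0 => _ [h _ <-] | exists g].
Qed.

(** Both sides are bounded through the individual g: the upper bound on dQ^2
    becomes an upper bound on every <g x, y>, and conversely every |x - g y| is
    at least the square root of the right-hand side when that is positive. *)
Lemma sqr_dQ (x y : H) :
  dQ act x y ^+ 2 = `|x| ^+ 2 + `|y| ^+ 2 - 2 * orbit_sup x y.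
Proof.
have dE g : `|x - act g y| ^+ 2
            = `|x| ^+ 2 + `|y| ^+ 2 - 2 * ip (act g^-1%g x) y.
  by rewrite sqr_normB (act_norm hact) act_adjoint invgK.
apply/le_anti/andP; split.
  suff : orbit_sup x y <= (`|x| ^+ 2 + `|y| ^+ 2 - dQ act x y ^+ 2) / 2 by lra.
  apply: orbit_sup_le => g.
  have : dQ act x y ^+ 2 <= `|x - act g^-1%g y| ^+ 2.
    by rewrite ler_sqr ?nnegrE ?dQ_ge0 ?dQ_le.
  by rewrite dE invgK; lra.
set c := (X in X <= _).
have [c0|c0] := leP c 0; first exact: le_trans c0 (sqr_ge0 _).
rewrite -(sqr_sqrtr (ltW c0)) ler_sqr ?nnegrE ?sqrtr_ge0 ?dQ_ge0//.
apply: le_dQ => g; rewrite -[leRHS](ger0_norm (normr_ge0 _)) -sqrtr_sqr.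
rewrite ler_sqrt ?sqr_ge0// dE /c.
by have := le_orbit_sup g^-1%g x y; lra.
Qed.

Lemma dQ_bounds (x y : H) : `|y| - `|x| <= dQ act x y <= `|x| + `|y|.
Proof.
apply/andP; split.
  by apply: le_dQ => g; rewrite -(act_norm hact g y) distrC lerB_dist.
apply: (le_trans (dQ_le x y 1%g)).
by rewrite (act_one hact) ler_normB.
Qed.

End Geometry.

(** * Functions of a random vector with a second moment *)

Section Expectation.
Context (R : realType) (H : completeNormedModType R).
Context (d : measure_display) (T : measurableType d) (P : probability T R).

(** The half-lines ]x, +oo[ generate the Borel sets of the reals, and their
    preimages by a continuous function are open. *)
Lemma continuous_random_element (X : T -> H) (f : H -> R) :
  random_element (borel_sets H) X -> continuous f ->
  measurable_fun setT (f \o X).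
Proof.
move=> mX cf; apply: (measurability _ (RGenOInfty.measurableE R)).
move=> _ [_ [x ->] <-]; rewrite setTI; apply: (mX (f @^-1` `]x, +oo[)).
apply: sub_sigma_algebra.
by apply: open_comp => [y _|]; [exact: cf | exact: interval_open].
Qed.

Lemma continuous_sqr_norm : continuous (fun y : H => `|y| ^+ 2).
Proof. by move=> y; apply: cvgM; exact: norm_continuous. Qed.

Definition square_integrable (X : T -> H) : Prop :=
  random_element (borel_sets H) X /\
  P.-integrable setT (EFin \o (fun w => `|X w| ^+ 2)).

Lemma expectation_Rintegral (X : T -> R) :
  P.-integrable setT (EFin \o X) -> ('E_P[X] = (\int[P]_w X w)%R%:E)%E.
Proof. by move=> iX; rewrite unlock fineK// integrable_fin_num. Qed.

Lemma integrable_affine (f : T -> R) (a b : R) :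
  P.-integrable setT (EFin \o f) ->
  P.-integrable setT (EFin \o (fun w => a + b * f w)).
Proof.
move=> i_f.
under [X in integrable _ _ X]eq_fun do rewrite /= EFinD EFinM.
apply: integrableD => //; last exact: integrableZl.
exact: (finite_measure_integrable_cst P a measurableT).
Qed.

Lemma Rintegral_probability_cst (c : R) : \int[P]_w (cst c w) = c.
Proof. by rewrite Rintegral_cst//= probability_setT mulr1. Qed.

Lemma square_integrable_le (X : T -> H) (f : H -> R) (a b : R) :
  square_integrable X -> continuous f ->
  (forall y, `|f y| <= a + b * `|y| ^+ 2) ->
  P.-integrable setT (EFin \o (fun w => f (X w))).
Proof.
move=> [mX iX] cf le_f.
have idom := integrable_affine a b iX.
apply: le_integrable idom => //.
  exact/measurable_EFinP/continuous_random_element.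
move=> w _ /=; rewrite lee_fin.
exact: le_trans (le_f _) (ler_norm _).
Qed.

End Expectation.

(** * The variance of a random orbit and its minimisers *)

Section AveragedOrbitSup.
Context (R : realType) (H : completeNormedModType R).
Context (ip : {dot H for idfun}) (hip : induces_norm ip).
Context (G : groupType) (act : G -> H -> H) (hact : isometric_action act).
Context (d : measure_display) (T : measurableType d) (P : probability T R).

Definition mean_orbit_sup (X : T -> H) (v : H) : R :=
  \int[P]_w orbit_sup ip act v (X w).

Lemma integrable_orbit_sup (X : T -> H) (v : H) : square_integrable P X ->
  P.-integrable setT (EFin \o (fun w => orbit_sup ip act v (X w))).
Proof.
move=> sX.
apply: (@square_integrable_le _ _ _ _ _ _ _ (`|v| / 2) (`|v| / 2) sX).
  exact: continuous_orbit_sup.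
move=> y; apply: le_trans (normr_orbit_sup hip hact v y) _.
(* |v| |y| <= |v| (1 + |y|^2) / 2, by (|y| - 1)^2 >= 0 *)
have := mulr_ge0 (normr_ge0 v) (sqr_ge0 (`|y| - 1)).
by lra.
Qed.

Lemma mean_orbit_supZ (X : T -> H) (s : R) (v : H) :
  square_integrable P X -> 0 <= s ->
  mean_orbit_sup X (s *: v) = s * mean_orbit_sup X v.
Proof.
move=> sX s0; rewrite -RintegralZl//; last exact: integrable_orbit_sup.
apply: eq_Rintegral => w _.
by rewrite -[X w in LHS]scale1r orbit_supZ// mulr1.
Qed.

Lemma variance_atE (X : T -> H) (x : H) : square_integrable P X ->
  variance_at act P X x =
  (`|x| ^+ 2 + \int[P]_w (`|X w| ^+ 2) - 2 * mean_orbit_sup X x)%:E.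
Proof.
move=> sX; have iS := integrable_orbit_sup x sX; have iN := proj2 sX.
have ic := finite_measure_integrable_cst P (`|x| ^+ 2) measurableT.
have iND : P.-integrable setT (EFin \o (fun w => `|x| ^+ 2 + `|X w| ^+ 2)).
  under [X in integrable _ _ X]eq_fun do rewrite /= EFinD.
  by apply: integrableD.
have i2S : P.-integrable setT (EFin \o (fun w => 2 * orbit_sup ip act x (X w))).
  under [X in integrable _ _ X]eq_fun do rewrite /= EFinM.
  by apply: integrableZl.
rewrite /variance_at.
under [X in expectation _ X]eq_fun do rewrite (sqr_dQ hip hact).
rewrite expectation_Rintegral; last first.
  under [X in integrable _ _ X]eq_fun do rewrite /= EFinB.
  by apply: integrableB.
rewrite RintegralB// RintegralD// RintegralZl//.
by rewrite (Rintegral_probability_cst P (`|x| ^+ 2)).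
Qed.

(** Along the ray of m the parabola s^2 |m|^2 - 2 s A(m), s >= 0, is minimal at
    s = 1; so, if m != 0, its vertex A(m) / |m|^2 is 1.  Up to its constant
    term the minimum of F is therefore -|m|^2, and comparing it with the least
    value -A(v)^2 / |v|^2 of the parabola of another ray, when A(v) > 0, gives
    A(v) <= |m| |v|. *)
Lemma frechet_mean_mean_orbit_sup (X : T -> H) (m : H) :
  square_integrable P X -> frechet_mean act P X m ->
  mean_orbit_sup X m = `|m| ^+ 2 /\
  (forall v, mean_orbit_sup X v <= `|m| * `|v|).
Proof.
move=> sX minm.
have {}minm x : `|m| ^+ 2 - 2 * mean_orbit_sup X m
             <= `|x| ^+ 2 - 2 * mean_orbit_sup X x.
  by have := minm x; rewrite !variance_atE// lee_fin; lra.
have ray v s : 0 <= s -> `|m| ^+ 2 - 2 * mean_orbit_sup X m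
    <= s ^+ 2 * `|v| ^+ 2 - 2 * s * mean_orbit_sup X v.
  move=> s0; have := minm (s *: v).
  rewrite mean_orbit_supZ// normrZ ger0_norm// exprMn; lra.
have A0 v : v = 0 -> mean_orbit_sup X v = 0.
  by move=> ->; rewrite -[0 : H](scale0r 0) mean_orbit_supZ// mul0r.
have sqv (v : H) : v != 0 -> 0 < `|v| ^+ 2.
  by move=> v0; rewrite exprn_gt0 ?normr_gt0.
have Am : mean_orbit_sup X m = `|m| ^+ 2.
  have [m0|m0] := eqVneq m 0; first by rewrite A0// m0 normr0 expr0n.
  have := sqv _ m0; move: (ray m).
  set q := `|m| ^+ 2; set a := mean_orbit_sup X m => raym q0.
  have [a0|a0] := leP 0 a; last by have := raym 0 (lexx 0); nra.
  have qa : (a / q) * q = a by rewrite divfK ?gt_eqF.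
  have := raym (a / q) (divr_ge0 a0 (ltW q0)).
  set s := a / q in qa *; have := sqr_ge0 (s - 1); nra.
split=> // v.
have [v0|v0] := eqVneq v 0; first by rewrite A0// v0 normr0 mulr0.
have [a0|a0] := leP (mean_orbit_sup X v) 0.
  by apply: le_trans a0 _; rewrite mulr_ge0.
have := sqv _ v0; have := ray v; rewrite Am.
move: a0; set a := mean_orbit_sup X v => a0 rayv q0.
rewrite -(ler_sqr) ?nnegrE ?mulr_ge0 ?(ltW a0)// exprMn.
have := rayv (a / `|v| ^+ 2) (divr_ge0 (ltW a0) (ltW q0)).
have qa : (a / `|v| ^+ 2) * `|v| ^+ 2 = a by rewrite divfK ?gt_eqF.
move: qa q0; set s := a / _; set q := `|v| ^+ 2; set r := `|m| ^+ 2; nra.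
Qed.

End AveragedOrbitSup.

(** * Stability under a bounded perturbation *)

Section Perturbation.
Context (R : realType) (H : completeNormedModType R).
Context (ip : {dot H for idfun}) (hip : induces_norm ip).
Context (G : groupType) (act : G -> H -> H) (hact : isometric_action act).
Context (d : measure_display) (T : measurableType d) (P : probability T R).
Context (X Z : T -> H) (t c : R) (le_c : forall w, `|X w - t *: Z w| <= c).

Lemma square_integrable_perturbation :
  random_element (borel_sets H) X -> square_integrable P Z ->
  square_integrable P X.
Proof.
move=> mX [mZ iZ]; split=> //.
have idom := integrable_affine (2 * c ^+ 2) (2 * t ^+ 2) iZ.
apply: le_integrable idom => //.
  apply/measurable_EFinP.
  apply: (continuous_random_element mX (f := fun y => `|y| ^+ 2)).
  exact: continuous_sqr_norm.
move=> w _ /=; rewrite lee_fin; apply: le_trans (ler_norm _).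
rewrite ger0_norm ?sqr_ge0//.
have leX : `|X w| <= c + `|t| * `|Z w|.
  rewrite -normrZ -[X w in leLHS](subrK (t *: Z w)).
  by apply: le_trans (ler_normD _ _) _; rewrite lerD2r.
have leX2 : `|X w| ^+ 2 <= (c + `|t| * `|Z w|) ^+ 2.
  by rewrite ler_sqr ?nnegrE// (le_trans _ leX).
(* (c + a)^2 <= 2 c^2 + 2 a^2 with a = |t| |Z w| *)
rewrite -(real_normK (num_real t)).
have := sqr_ge0 (c - `|t| * `|Z w|); nra.
Qed.

Lemma mean_orbit_sup_perturbation (v : H) :
  square_integrable P X -> square_integrable P Z -> 0 <= t ->
  `|mean_orbit_sup ip act P X v - t * mean_orbit_sup ip act P Z v| <= `|v| * c.
Proof.
move=> sX sZ t0.
have iX := integrable_orbit_sup hip hact v sX.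
have iZ := integrable_orbit_sup hip hact v sZ.
have itZ : P.-integrable setT (EFin \o (fun w => t * orbit_sup ip act v (Z w))).
  under [X in integrable _ _ X]eq_fun do rewrite /= EFinM.
  by apply: integrableZl.
have iXZ : P.-integrable setT
    (EFin \o (fun w =>
      orbit_sup ip act v (X w) - t * orbit_sup ip act v (Z w))).
  under [X in integrable _ _ X]eq_fun do rewrite /= EFinB.
  by apply: integrableB.
have icst r := finite_measure_integrable_cst P r measurableT.
have lip w : `|orbit_sup ip act v (X w) - t * orbit_sup ip act v (Z w)|
             <= `|v| * c.
  have tZ := orbit_supZ hip hact v (Z w) ler01 t0.
  rewrite scale1r mul1r in tZ; rewrite -tZ.
  have le1 := orbit_sup_lipschitz hip hact v (X w) (t *: Z w).
  have le2 := orbit_sup_lipschitz hip hact v (t *: Z w) (X w).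
  have le3 : `|v| * `|X w - t *: Z w| <= `|v| * c by rewrite ler_wpM2l.
  by rewrite distrC in le2; rewrite ler_norml; lra.
rewrite /mean_orbit_sup -RintegralZl// -RintegralB// ler_norml.
rewrite -{1}(Rintegral_probability_cst P (- (`|v| * c))).
rewrite -{2}(Rintegral_probability_cst P (`|v| * c)).
apply/andP; split; apply: le_Rintegral => // w _;
  by have := lip w; rewrite ler_norml => /andP[].
Qed.

End Perturbation.

(** * The noise constant *)

Section NoiseConstant.
Context (R : realType) (H : completeNormedModType R).
Context (ip : {dot H for idfun}) (hip : induces_norm ip).
Context (G : groupType) (act : G -> H -> H) (hact : isometric_action act).
Context (d : measure_display) (T : measurableType d) (P : probability T R).
Context (eps : T -> H) (heps : random_element (borel_sets H) eps).

Lemma square_integrable_noise :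
  ('E_P[fun w => (`|eps w| ^+ 2)%R] = 1)%E -> square_integrable P eps.
Proof.
move=> hvar; split=> //; apply/integrableP; split.
  apply/measurable_EFinP.
  apply: (continuous_random_element heps (f := fun y => `|y| ^+ 2)).
  exact: continuous_sqr_norm.
under eq_integral do rewrite /= ger0_norm ?sqr_ge0//.
by move: hvar; rewrite unlock => ->; rewrite ltry.
Qed.

Lemma mean_orbit_sup_le_norm (v : H) :
  ('E_P[fun w => (`|eps w| ^+ 2)%R] = 1)%E ->
  mean_orbit_sup ip act P eps v <= `|v|.
Proof.
move=> hvar; have sE := square_integrable_noise hvar; have i2 := proj2 sE.
have R1 : \int[P]_w (`|eps w| ^+ 2) = 1.
  by apply: EFin_inj; rewrite -expectation_Rintegral.
have iN : P.-integrable setT (EFin \o (fun w => `|v| / 2 * `|eps w| ^+ 2)).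
  under [X in integrable _ _ X]eq_fun do rewrite /= EFinM.
  by apply: integrableZl.
have icst := finite_measure_integrable_cst P (`|v| / 2) measurableT.
have -> : `|v| = \int[P]_w (`|v| / 2 + `|v| / 2 * `|eps w| ^+ 2).
  rewrite RintegralD// (RintegralZl _ measurableT i2).
  by rewrite (Rintegral_probability_cst P (`|v| / 2)) R1; lra.
apply: le_Rintegral => //.
- exact: integrable_orbit_sup.
- exact: integrable_affine.
move=> w _; apply: le_trans (ler_norm _) _.
apply: le_trans (normr_orbit_sup hip hact v (eps w)) _.
by have := mulr_ge0 (normr_ge0 v) (sqr_ge0 (`|eps w| - 1)); lra.
Qed.

(** For x in the support and g0 x != x, the vector v = g0^-1 x has the norm of x
    and is distinct from x, so <x, x> > <v, x>.  By continuity <g0 v, .> exceeds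
    <v, .> by a fixed amount near x, an event of positive probability, while
    <v, eps> has mean zero. *)
Lemma exists_mean_orbit_sup_gt0 :
  square_integrable P eps -> has_mean ip P eps 0 ->
  ~ (rv_support P eps `<=` fixed_points act) ->
  exists2 v : H, `|v| = 1 & 0 < mean_orbit_sup ip act P eps v.
Proof.
move=> sE hmean /existsNP[x /not_implyP[suppx /existsNP[g0 gx]]].
set v := act g0^-1%g x.
have Nv : `|v| = `|x| by rewrite (act_norm hact).
have xv_neq0 : 0 < `|x - v|.
  rewrite normr_gt0 subr_eq0; apply: contra_notN gx => /eqP xv.
  by rewrite [X in act g0 X]xv (act_mul hact) mulgV (act_one hact).
have x_gt0 : 0 < `|x|.
  by have := ler_normB x v; rewrite Nv; lra.
(* delta = <x - v, x>, and a radius r with |x - v| r = delta / 2 *)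
pose delta := `|x - v| ^+ 2 / 2.
have delta0 : 0 < delta by rewrite divr_gt0 ?exprn_gt0.
have deltaE : ip (x - v) x = delta.
  by rewrite /delta (sqr_normB hip) Nv linearBl /= (dotC ip v) -hip; lra.
pose r := `|x - v| / 4.
have r0 : 0 < r by rewrite divr_gt0.
pose B := eps @^-1` ball x r.
have mB : measurable B.
  by apply: heps; apply: sub_sigma_algebra; exact: ball_open.
have PB : 0 < fine (P B).
  by apply: fine_gt0; rewrite suppx//= ltey_eq fin_num_measure.
have [iv Ev] := hmean v.
have Rv : \int[P]_w ip v (eps w) = 0.
  by apply: EFin_inj; rewrite -expectation_Rintegral// Ev linear0r.
have iS := integrable_orbit_sup hip hact v sE.
have iB : P.-integrable setT (EFin \o (fun w => delta / 2 * \1_B w)).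
  under [X in integrable _ _ X]eq_fun do rewrite /= EFinM.
  by apply: integrableZl => //; exact: integrable_indic mB.
have RB : \int[P]_w \1_B w = fine (P B).
  by rewrite /Rintegral integral_indic// setIT.
have iBv : P.-integrable setT
    (EFin \o (fun w => ip v (eps w) + delta / 2 * \1_B w)).
  under [X in integrable _ _ X]eq_fun do rewrite /= EFinD.
  by apply: integrableD.
have Av : 0 < mean_orbit_sup ip act P eps v.
  have : \int[P]_w (ip v (eps w) + delta / 2 * \1_B w)
         <= mean_orbit_sup ip act P eps v.
    apply: le_Rintegral => // w _.
    have [wB|wB] := pselect (B w); last first.
      by rewrite indicE memNset// mulr0 addr0 dot_le_orbit_sup.
    rewrite indicE mem_set// mulr1.
    have := le_orbit_sup hip hact g0 v (eps w).
    rewrite (act_mul hact) mulgV (act_one hact).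
    have : ip (x - v) (x - eps w) <= `|x - v| * r.
      apply: le_trans (dot_le_norm hip _ _) _.
      by rewrite ler_wpM2l// ltW//; move: wB; rewrite /B /= -ball_normE.
    rewrite linearBr /= deltaE linearBl /= /r.
    by rewrite /delta in delta0 *; lra.
  apply: lt_le_trans; rewrite RintegralD// Rv add0r RintegralZl//; last first.
    exact: integrable_indic.
  by rewrite RB; apply: mulr_gt0 => //; apply: divr_gt0.
exists (`|x|^-1 *: v).
  by rewrite normrZ Nv ger0_norm ?invr_ge0// mulVf ?gt_eqF.
by rewrite mean_orbit_supZ ?invr_ge0// mulr_gt0 ?invr_gt0.
Qed.

Lemma noise_constantE : square_integrable P eps ->
  noise_constant ip act P eps =
  ereal_sup [set (mean_orbit_sup ip act P eps v)%:E
            | v in [set v : H | `|v| = 1]].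
Proof.
move=> sE; congr ereal_sup; apply: eq_imagel => v _.
by rewrite expectation_Rintegral//; exact: integrable_orbit_sup.
Qed.

End NoiseConstant.

(** * The consistency bias *)

Theorem theorem1 (R : realType) (H : completeNormedModType R)
    (ip : {dot H for idfun}) (hip : induces_norm ip)
    (G : groupType) (act : G -> H -> H) (hact : isometric_action act)
    (SG : set (set G)) (hSG : sigma_algebra [set: G] SG)
    (d : measure_display) (T : measurableType d) (P : probability T R)
    (t0 : H) (phi : T -> G) (eps : T -> H)
    (hphi : random_element SG phi)
    (heps : random_element (borel_sets H) eps)
    (hY : forall sigma : R, 0 < sigma ->
      random_element (borel_sets H) (observation act phi t0 eps sigma))
    (hindep : independent P SG (borel_sets H) phi eps)
    (hmean : has_mean ip P eps 0)
    (hvar : ('E_P[fun w => (`|eps w| ^+ 2)%R] = 1)%E)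
    (hsupp : ~ (rv_support P eps `<=` fixed_points act)) :
  let K := noise_constant ip act P eps in
  let Y := observation act phi t0 eps in
  let CB := consistency_bias act t0 in
  [/\ (0 < K)%E /\ (K <= 1)%E,
      forall (sigma : R) (m : H), 0 < sigma -> frechet_mean act P (Y sigma) m ->
        sigma * fine K - 2 * `|t0| <= CB m /\
        CB m <= sigma * fine K + 2 * `|t0|
    & forall (S : set R) (m : R -> H),
        S `<=` [set sigma | 0 < sigma] ->
        (forall sigma, S sigma -> frechet_mean act P (Y sigma) (m sigma)) ->
        (fun sigma : R => CB (m sigma)) =
        (fun sigma : R => sigma * fine K)
          +o_ (within S (pinfty_nbhs R)) (fun sigma : R => sigma) ].
Proof.
move=> K Y CB.
have sE : square_integrable P eps := square_integrable_noise heps hvar.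
have KE := noise_constantE hip hact sE; rewrite -/K in KE.
have [v0 v01 Av0] := exists_mean_orbit_sup_gt0 hip hact heps sE hmean hsupp.
have A_le v : `|v| = 1 -> ((mean_orbit_sup ip act P eps v)%:E <= K)%E.
  by move=> v1; rewrite KE; apply: ereal_sup_ubound; exists v.
have K0 : (0 < K)%E by apply: lt_le_trans (A_le v0 v01); rewrite lte_fin.
have K1 : (K <= 1)%E.
  rewrite KE; apply: ge_ereal_sup => _ [v /= v1 <-].
  by rewrite lee_fin -v1; exact: mean_orbit_sup_le_norm.
have Kfin : K \is a fin_num.
  by rewrite ge0_fin_numE ?ltW// (le_lt_trans K1)// ltry.
have fK0 : 0 < fine K by rewrite fine_gt0// K0 ltey_eq Kfin.
(* |m| = max(0, sup A_Y) on the unit sphere, and sup A_Y is within |t0| of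
   sigma K; the truncation at 0 is harmless since sigma K >= 0 *)
have norm_m sigma m : 0 < sigma -> frechet_mean act P (Y sigma) m ->
    sigma * fine K - `|t0| <= `|m| <= sigma * fine K + `|t0|.
  move=> s0 minm.
  have closeY w : `|Y sigma w - sigma *: eps w| <= `|t0|.
    by rewrite /Y /observation addrK (act_norm hact).
  have sY := square_integrable_perturbation closeY (hY _ s0) sE.
  have [Am Av] := frechet_mean_mean_orbit_sup hip hact sY minm.
  have AY v : `|v| = 1 ->
      `|mean_orbit_sup ip act P (Y sigma) v
        - sigma * mean_orbit_sup ip act P eps v| <= `|t0|.
    move=> v1.
    have := mean_orbit_sup_perturbation hip hact closeY v sY sE (ltW s0).
    by rewrite v1 mul1r.
  apply/andP; split.
    suff leK : (K <= ((`|m| + `|t0|) / sigma)%:E)%E.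
      have : fine K <= (`|m| + `|t0|) / sigma by rewrite -lee_fin fineK.
      by rewrite ler_pdivlMr// mulrC; lra.
    rewrite KE; apply: ge_ereal_sup => _ [v /= v1 <-].
    rewrite lee_fin ler_pdivlMr// mulrC.
    by have := AY v v1; have := Av v; rewrite v1 mulr1 ler_norml; lra.
  have [->|m0] := eqVneq m 0.
    by rewrite normr0 addr_ge0// mulr_ge0// ltW.
  have nm0 : 0 < `|m| by rewrite normr_gt0.
  pose v := `|m|^-1 *: m.
  have v1 : `|v| = 1 by rewrite normrZ ger0_norm ?invr_ge0// mulVf ?gt_eqF.
  have AvE : mean_orbit_sup ip act P (Y sigma) v = `|m|.
    by rewrite mean_orbit_supZ ?invr_ge0// Am expr2 mulKf ?gt_eqF.
  have leK : mean_orbit_sup ip act P eps v <= fine K.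
    by have := A_le v v1; rewrite -{1}(fineK Kfin) lee_fin.
  have := ler_wpM2l (ltW s0) leK.
  by have := AY v v1; rewrite AvE ler_norml; lra.
have CB_bounds sigma m : 0 < sigma -> frechet_mean act P (Y sigma) m ->
    sigma * fine K - 2 * `|t0| <= CB m /\ CB m <= sigma * fine K + 2 * `|t0|.
  move=> s0 minm; have := norm_m _ _ s0 minm.
  have := dQ_bounds hact t0 m.
  by rewrite -/(consistency_bias act t0 m) -/(CB m); lra.
split=> // S m S0 minm; apply/eqaddoP => e e0.
(* the error 2 |t0| is at most e * s once s >= 2 |t0| / e *)
have : \forall s \near pinfty_nbhs R, 2 * `|t0| / e <= s.
  by apply: nbhs_pinfty_ge; rewrite num_real.
apply: filterS => s les Ss.
have s0 := S0 _ Ss.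
have [lo hi] := CB_bounds _ _ s0 (minm _ Ss).
rewrite (gtr0_norm s0) (_ : (_ - _) s = CB (m s) - s * fine K)//.
by rewrite ler_pdivrMr// mulrC in les; rewrite ler_norml; lra.
Qed.
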